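(* Let $0<a<b<1$. If $b-a\le\frac{2}{15}$, then $(a,b)\in D_3$. On the other hand, if $(a,b)\in D_3$, then $b-a\le\frac37$.
   Context: Let $T:[0,1]\to[0,1]$ be the doubling map: $Tx=2x$ for $x\in[0,1/2]$ and $Tx=2x-1$ for $x\in(1/2,1]$. An $n$-cycle is a periodic orbit of $T$ of prime (least) period $n$. For $0<a<b<1$, an integer $n\ge 3$ is called bad for $(a,b)$ if every $n$-cycle of $T$ has non-empty intersection with the open interval $(a,b)$. $B(a,b)$ denotes the set of all $n\ge3$ which are bad for $(a,b)$, and $D_3=\{(a,b)\in(0,1)\times(0,1): B(a,b)=\varnothing\}$. *)

(* Defs.v *)
From HB Require Import structures.
From mathcomp Require Import all_boot all_order all_algebra.
From mathcomp Require Import boolp classical_sets reals.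

Set Implicit Arguments.
Unset Strict Implicit.
Unset Printing Implicit Defensive.

Import Order.TTheory GRing.Theory Num.Theory.
Local Open Scope classical_set_scope.
Local Open Scope ring_scope.

(* The map of [0, 1] is given by its formula on all of R; [is_cycle] below
   only looks at points of [0, 1], which the formula sends into [0, 1]. *)
Definition doubling (R : realType) (x : R) : R :=
  if x <= 1 / 2 then 2 * x else 2 * x - 1.

Definition has_prime_period (X : Type) (f : X -> X) (n : nat) (x : X) : Prop :=
  [/\ (0 < n)%N, iter n f x = x &
      forall m : nat, (0 < m < n)%N -> iter m f x <> x].

Definition orbit_of (X : Type) (f : X -> X) (x : X) : set X :=
  [set iter k f x | k in [set: nat]].

Definition is_cycle (R : realType) (n : nat) (C : set R) : Prop :=
  exists x : R, [/\ 0 <= x <= 1, has_prime_period (@doubling R) n x &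
                    C = orbit_of (@doubling R) x].

Definition bad (R : realType) (a b : R) (n : nat) : Prop :=
  (3 <= n)%N /\
  forall C : set R, is_cycle n C -> C `&` [set x | a < x < b] !=set0.

Definition B (R : realType) (a b : R) : set nat := [set n | bad a b n].

Definition D3 (R : realType) : set (R * R) :=
  [set ab | [/\ 0 < ab.1 < 1, 0 < ab.2 < 1 & B ab.1 ab.2 = set0]].

(* Main.v *)
Require Import Defs.
From HB Require Import structures.
From mathcomp Require Import all_boot all_order all_algebra.
From mathcomp Require Import boolp classical_sets reals.
From mathcomp Require Import zify ring lra.

Import Order.TTheory GRing.Theory Num.Theory.
Local Open Scope classical_set_scope.
Local Open Scope ring_scope.

(** If [b - a > 3/7] then [(a, b)] meets both 3-cycles [{1,2,4}/7] and
    [{3,5,6}/7], so 3 is bad.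

    If [b - a <= 2/15], the symmetry [x -> 1 - x] lets us assume [a + b <= 1].
    With [N = 2^n - 1], the cycle of [1 - 1/N] lies above [1 - 2^(n-1)/N], so it
    avoids [(a, b)] unless [b] is close to [1/2] or larger; in that case
    [(a, b)] is contained in [(1/3, 4/7)] for [n >= 4].  A periodic binary
    expansion made of the blocks 10 and 100 never enters [(1/3, 4/7)], and
    primitive words of length [n] in these blocks exist for all [n >= 3] but 4
    and 6.  The periods 3, 4 and 6 are settled with explicit cycles. *)

(** * Cycles that miss an interval *)

Definition avoidable {R : realType} (n : nat) (a b : R) : Prop :=
  exists2 C : set R, is_cycle n C & forall x, C x -> ~ (a < x < b).

Lemma avoidable_not_bad (R : realType) n (a b : R) :
  avoidable n a b -> ~ bad a b n.
Proof.
case=> C hC hav [_ /(_ C hC)] [x [Cx /=]]; exact: hav.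
Qed.

Lemma avoidable_sub (R : realType) n (a b c d : R) :
  c <= a -> b <= d -> avoidable n c d -> avoidable n a b.
Proof.
move=> ca bd [C hC hav]; exists C => // x /hav h /andP[ax xb].
by apply: h; rewrite (le_lt_trans ca ax) (lt_le_trans xb bd).
Qed.

Lemma doublingL (R : realType) (x : R) : x <= 1 / 2 -> doubling x = 2 * x.
Proof. by rewrite /doubling => ->. Qed.

Lemma doublingR (R : realType) (x : R) : 1 / 2 < x -> doubling x = 2 * x - 1.
Proof. by rewrite /doubling leNgt => ->. Qed.

Lemma iter_modn (X : Type) (f : X -> X) n k x :
  iter n f x = x -> iter k f x = iter (k %% n) f x.
Proof.
move=> hx; rewrite {1}(divn_eq k n) addnC iterD; congr (iter _ f _).
by elim: (k %/ n)%N => // q IH; rewrite mulSn iterD IH.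
Qed.

(** Allows a cycle to be given by a closed formula or a list of points: [p] has to follow the orbit
    only up to index [n]. *)
Lemma avoidableI (R : realType) n (a b : R) (p : nat -> R) :
  (0 < n)%N -> 0 <= p 0 <= 1 ->
  (forall k, (k < n)%N -> doubling (p k) = p k.+1) ->
  p n = p 0 -> (forall k, (0 < k < n)%N -> p k <> p 0) ->
  (forall k, (k < n)%N -> ~ (a < p k < b)) ->
  avoidable n a b.
Proof.
move=> n0 p01 pS pn pprime pav.
have pE k : (k <= n)%N -> iter k (@doubling R) (p 0) = p k.
  by elim: k => // k IH kn; rewrite iterS IH ?pS // ltnW.
have xn : iter n (@doubling R) (p 0) = p 0 by rewrite pE.
exists (orbit_of (@doubling R) (p 0)).
  exists (p 0); split=> //; split=> // m /andP[m0 mn].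
  by rewrite pE ?(ltnW mn) //; apply: pprime; rewrite m0.
move=> _ [k _ <-]; rewrite (iter_modn _ _ _ _ _ xn).
by have kn := ltn_pmod k n0; rewrite pE ?(ltnW kn) //; apply: pav.
Qed.

Lemma iter_doubling1 (R : realType) k : iter k (@doubling R) 1 = 1.
Proof. by elim: k => //= k ->; rewrite doublingR; lra. Qed.

(** The reflection [x -> 1 - x] commutes with the doubling map except at [1 / 2], which is sent to
    the fixed point 1 and so lies on no cycle of length above 1. *)
Lemma avoidable_mirror (R : realType) n (a b : R) :
  (1 < n)%N -> avoidable n a b -> avoidable n (1 - b) (1 - a).
Proof.
move=> n1 [_ [x [x01 [n0 xn xprime] ->]] xav].
pose T := @doubling R.
have xNhalf k : iter k T x <> 1 / 2.
  move=> xk; have xk1 : iter k.+1 T x = 1.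
    by rewrite iterS xk /T doublingL; lra.
  (* [k.+1 * n] is a multiple of the period and at least [k.+1], so the orbit returns to [x] after
     reaching 1, forcing [x = 1]. *)
  have : iter (k.+1 * n - k.+1 + k.+1) T x = x.
    by rewrite subnK ?leq_pmulr // (iter_modn _ _ _ _ _ xn) modnMl.
  rewrite iterD xk1 iter_doubling1 => x1.
  by apply: (xprime 1%N); rewrite ?n1 //= -x1 doublingR; lra.
apply: (@avoidableI _ _ _ _ (fun k => 1 - iter k T x)) => //=.
- by lra.
- move=> k _; move: (iter k T x) (xNhalf k) => y yNhalf; rewrite /T.
  have [h|h] := lerP y (1 / 2); last by rewrite (doublingR _ y) // doublingL; lra.
  have : y < 1 / 2 by rewrite lt_neqAle h andbT; apply/eqP.
  by rewrite (doublingL _ y) // => ?; rewrite doublingR; lra.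
- by rewrite xn.
- by move=> k /xprime kx h; apply: kx; rewrite -/T; lra.
- move=> k _ /andP[h1 h2]; apply: (xav (iter k T x)); first by exists k.
  by apply/andP; split; lra.
Qed.

Lemma avoidable_ones (R : realType) n (a b : R) : (1 < n)%N ->
  b <= 1 - 2 ^+ n.-1 / (2 ^+ n - 1) -> avoidable n a b.
Proof.
case: n => [|n] //= n0; set N := 2 ^+ n.+1 - 1 => bq.
have p1 k : 1 <= 2 ^+ k :> R by rewrite exprn_ege1 // ler1n.
have NE : N = 2 * 2 ^+ n - 1 by rewrite /N exprS.
have N0 : 0 < N by rewrite NE; have := p1 n; lra.
pose q k := 2 ^+ k / N; pose d := 1 / N.
have q0d : q 0 = d by rewrite /q expr0.
have qS k : q k.+1 = 2 * q k by rewrite /q exprS mulrA.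
have qmono j k : (j <= k)%N -> q j <= q k.
  by move=> jk; rewrite ler_pM2r ?invr_gt0 // ler_weXn2l // ler1n.
have qn : 2 * q n = 1 + d.
  by rewrite /q mulrA -[2 * _](subrK 1) -NE mulrDl divff // gt_eqF.
have d0 : 0 < d by rewrite divr_gt0.
have dn : 2 * d <= q n by rewrite -q0d -qS; apply: qmono.
rewrite -/(q n) in bq; move: q d bq q0d qS qmono qn d0 dn => q d bq q0d qS qmono qn d0 dn.
(* At index [n.+1] the formula [1 - q k] would give [- d]; the orbit, leaving a point below [1 / 2],
   closes up at [1 - d] instead. *)
apply: (@avoidableI _ _ _ _
  (fun k => if k == n.+1 then 1 - d else 1 - q k)) => //=.
- by rewrite q0d; apply/andP; split; lra.
- move=> k; rewrite ltnS => kn; rewrite ltn_eqF ?ltnS // eqSS.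
  case: eqP => [->|/eqP nk]; first by rewrite doublingL; lra.
  have {}kn : (k < n)%N by rewrite ltn_neqAle nk.
  have := qmono _ _ kn; rewrite qS => h.
  by rewrite doublingR ?qS; lra.
- by rewrite eqxx q0d.
- move=> k /andP[k0 kn]; rewrite ltn_eqF // q0d => h.
  by have := qmono _ _ k0; rewrite qS q0d; lra.
- move=> k kn; rewrite ltn_eqF // => /andP[_ h].
  by have := qmono k n kn; lra.
Qed.

(** * Periodic expansions in the blocks 10 and 100 *)

(* Starting from the smallest orbit point above [1/3] makes a single hypothesis
   give both the avoidance and the primality of the period. *)
Lemma avoidable_first_return (R : realType) n (x : R) :
  (0 < n)%N -> 4 / 7 <= x <= 1 -> iter n (@doubling R) x = x ->
  (forall k, (0 < k < n)%N ->
     iter k (@doubling R) x <= 1 / 3 \/ x < iter k (@doubling R) x) ->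
  avoidable n (1 / 3 : R) (4 / 7).
Proof.
move=> n0 x01 xn xout.
apply: (@avoidableI _ _ _ _ (fun k => iter k (@doubling R) x)) => //=.
- by lra.
- by move=> k /xout [] h e; lra.
- by move=> [|k] kn /=; [lra | have := xout k.+1; rewrite kn => /(_ isT) [] /= h; lra].
Qed.

(** [prefix10 y] and [prefix100 y] prepend the binary digits 10 and 100 to the
    expansion of [y]. *)
Definition prefix10 {R : realType} (y : R) : R := 1 / 2 + y / 4.
Definition prefix100 {R : realType} (y : R) : R := 1 / 2 + y / 8.

(** The bounds 4/7 and 2/3 are the fixed points of [prefix100] and [prefix10]; both maps preserve
    the interval between them. *)
Lemma doubling_prefix10 (R : realType) (y : R) : 4 / 7 <= y <= 2 / 3 ->
  doubling (prefix10 y) = y / 2 /\ doubling (y / 2) = y.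
Proof. by move=> hy; split; [rewrite doublingR /prefix10 | rewrite doublingL]; lra. Qed.

Lemma doubling_prefix100 (R : realType) (y : R) : 4 / 7 <= y <= 2 / 3 ->
  [/\ doubling (prefix100 y) = y / 4, doubling (y / 4) = y / 2 &
      doubling (y / 2) = y].
Proof.
by move=> hy; split; [rewrite doublingR /prefix100 | rewrite doublingL..]; lra.
Qed.

(* 2/3 is the fixed point of [prefix10]. *)
Lemma iter_prefix10E (R : realType) k (y : R) :
  iter k (@prefix10 R) y = 2 / 3 + (y - 2 / 3) / 4 ^+ k.
Proof.
elim: k => [|k IH]; first by rewrite expr0 divr1 /=; lra.
have := expf_neq0 k (_ : 4 != 0 :> R); rewrite pnatr_eq0 => /(_ isT) h.
by rewrite iterS IH /prefix10 exprS; field.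
Qed.

Lemma iter_prefix10_itv (R : realType) k (y : R) : 4 / 7 <= y <= 2 / 3 ->
  4 / 7 <= iter k (@prefix10 R) y <= 2 / 3.
Proof. by move=> hy; elim: k => //= k; rewrite /prefix10; lra. Qed.

Lemma iter_doubling_prefix10 (R : realType) k (y : R) :
  4 / 7 <= y <= 2 / 3 ->
  iter (2 * k) (@doubling R) (iter k (@prefix10 R) y) = y.
Proof.
move=> hy; elim: k => // k IH.
have [e1 e2] := doubling_prefix10 _ _ (iter_prefix10_itv _ k _ hy).
by rewrite mulnS addnC iterD /= e1 e2.
Qed.

(** Mid-block points are halves of numbers at most 2/3; block starts are at least
    [prefix10 (4 / 7)], which is 9/14. *)
Lemma doubling_prefix10_out (R : realType) k m (y : R) :
  4 / 7 <= y <= 2 / 3 -> (m < 2 * k)%N ->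
  let z := iter m (@doubling R) (iter k (@prefix10 R) y) in
  z <= 1 / 3 \/ 9 / 14 <= z.
Proof.
move=> hy; elim: k m => // k IH m mk.
have hz := iter_prefix10_itv _ k _ hy.
have [e1 e2] := doubling_prefix10 _ _ hz.
case: m mk => [|[|m]] mk.
- by right; rewrite /= /prefix10; lra.
- by left; rewrite /= e1; lra.
- by rewrite 2!iterSr [iter k.+1 _ _]iterS e1 e2; apply: IH; lia.
Qed.

Lemma inv4X_itv (R : realType) k : 0 < (4 ^+ k : R)^-1 <= 1.
Proof. by rewrite invr_gt0 exprn_gt0 //= invf_le1 ?exprn_gt0 // exprn_ege1 // ler1n. Qed.

Lemma avoidable_odd (R : realType) k :
  avoidable (2 * k + 3) (1 / 3 : R) (4 / 7).
Proof.
pose q : R := (4 ^+ k)^-1; have hq : 0 < q <= 1 := inv4X_itv R k.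
(* The point with the periodic expansion 100(10)^k. *)
pose x : R := (14 - 2 * q) / (24 - 3 * q).
have xE : x * (24 - 3 * q) = 14 - 2 * q by rewrite /x divfK //; lra.
(* 7/12 is [prefix100 (2 / 3)]; being below 9/14, it puts [x] before every start of a block 10. *)
have hx : 4 / 7 <= x <= 7 / 12.
  by rewrite /x ler_pdivlMr ?ler_pdivrMr; lra.
have hx' : 4 / 7 <= x <= 2 / 3 by lra.
pose z := iter k (@prefix10 R) x.
have hz : 4 / 7 <= z <= 2 / 3 by apply: iter_prefix10_itv.
(* [x] was chosen to solve this linear equation, [z] being affine in [x] with slope [q]. *)
have xz : x = prefix100 z.
  by rewrite /prefix100 /z iter_prefix10E -/q; lra.
have [e1 e2 e3] := doubling_prefix100 _ _ hz.
have e : iter 3 (@doubling R) x = z by rewrite /= {1}xz e1 e2 e3.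
apply: (@avoidable_first_return _ _ x); first by rewrite addn_gt0 orbT.
- by lra.
- by rewrite iterD e iter_doubling_prefix10.
case=> [|[|[|m]]] // mk.
- by left; rewrite /= {1}xz e1; lra.
- by left; rewrite /= {1}xz e1 e2; lra.
- rewrite -[m.+3]/(3 + m)%N addnC iterD e.
  have [|h|h] := @doubling_prefix10_out _ k m x hx'.
  - by rewrite -(ltn_add2r 3) [(m + 3)%N]addnC.
  - by left.
  - by right; lra.
Qed.

(** An even length needs an even number of blocks 100. At least one block 10 is required, since
    100100 is not primitive. *)
Lemma avoidable_even (R : realType) k :
  avoidable (2 * k.+1 + 6) (1 / 3 : R) (4 / 7).
Proof.
pose q : R := (4 ^+ k.+1)^-1; have hq : 0 < q <= 1 := inv4X_itv R k.+1.
(* The point with the periodic expansion 100100(10)^(k+1). *)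
pose x : R := (110 - 2 * q) / (192 - 3 * q).
have xE : x * (192 - 3 * q) = 110 - 2 * q by rewrite /x divfK //; lra.
have hx : 4 / 7 <= x <= 7 / 12.
  by rewrite /x ler_pdivlMr ?ler_pdivrMr; lra.
have hx' : 4 / 7 <= x <= 2 / 3 by lra.
pose z := iter k.+1 (@prefix10 R) x.
have hz : 9 / 14 <= z <= 2 / 3.
  rewrite /z iterS; move: (iter _ _ _) (iter_prefix10_itv _ k _ hx') => y hy.
  by rewrite /prefix10; lra.
have hz' : 4 / 7 <= z <= 2 / 3 by lra.
pose w := prefix100 z.
have hw : 4 / 7 <= w <= 2 / 3 by rewrite /w /prefix100; lra.
have xw : x = prefix100 w.
  by rewrite /w /prefix100 /z iter_prefix10E -/q; lra.
(* After its first block 100, [x] continues with another 100 and [w] with a 10, so [x] is the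
   smaller: [w <= 7 / 12 < 9 / 14 <= z]. *)
have xltw : x < w by rewrite xw /w /prefix100; lra.
have [e1 e2 e3] := doubling_prefix100 _ _ hz'.
have [f1 f2 f3] := doubling_prefix100 _ _ hw.
have f : iter 3 (@doubling R) x = w by rewrite /= {1}xw f1 f2 f3.
have e : iter 6 (@doubling R) x = z by rewrite (iterD 3 3) f /= e1 e2 e3.
apply: (@avoidable_first_return _ _ x); first by rewrite addn_gt0 orbT.
- by lra.
- by rewrite iterD e iter_doubling_prefix10.
case=> [|[|[|[|[|[|m]]]]]] // mk.
- by left; rewrite /= {1}xw f1; lra.
- by left; rewrite /= {1}xw f1 f2; lra.
- by right; rewrite f.
- by left; rewrite (iterD 1 3) f /= e1; lra.
- by left; rewrite (iterD 2 3) f /= e1 e2; lra.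
- rewrite -[m.+4.+2]/(6 + m)%N addnC iterD e.
  have [|h|h] := @doubling_prefix10_out _ k.+1 m x hx'.
  - by rewrite -(ltn_add2r 6) [(m + 6)%N]addnC.
  - by left.
  - by right; lra.
Qed.

(** * Explicit cycles of periods 3, 4 and 6 *)

(** The list ends with its first point again, to supply [p n = p 0]. Each interval below is a gap
    between neighbouring points of the cycle. *)
Ltac explicit_cycle l :=
  apply: (@avoidableI _ _ _ _ (nth 0 l)) => //=;
  [ by lra
  | by repeat case=> //; move=> _ /=; rewrite /doubling; case: lerP; lra
  | by repeat case=> //; move=> _ /=; lra
  | by repeat case=> //; move=> _ /=; lra ].

Lemma avoidable_3 (R : realType) : avoidable 3 (2 / 7 : R) (4 / 7).
Proof. explicit_cycle [:: 1/7; 2/7; 4/7; 1/7 : R]. Qed.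

Lemma avoidable_4_left (R : realType) : avoidable 4 (4 / 15 : R) (8 / 15).
Proof. explicit_cycle [:: 1/15; 2/15; 4/15; 8/15; 1/15 : R]. Qed.

Lemma avoidable_4_center (R : realType) : avoidable 4 (6 / 15 : R) (9 / 15).
Proof. explicit_cycle [:: 3/15; 6/15; 12/15; 9/15; 3/15 : R]. Qed.

Lemma avoidable_6_left (R : realType) : avoidable 6 (20 / 63 : R) (34 / 63).
Proof.
explicit_cycle [:: 5/63; 10/63; 20/63; 40/63; 17/63; 34/63; 5/63 : R].
Qed.

Lemma avoidable_6_center (R : realType) : avoidable 6 (25 / 63 : R) (37 / 63).
Proof.
explicit_cycle [:: 11/63; 22/63; 44/63; 25/63; 50/63; 37/63; 11/63 : R].
Qed.

(** * Intervals of length at most 2/15 *)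

Lemma avoidable_third (R : realType) n : (3 <= n)%N -> n != 4 -> n != 6 ->
  avoidable n (1 / 3 : R) (4 / 7).
Proof.
move=> n3 n4 n6; have := odd_double_half n; case: (odd n) => e.
  have -> : n = (2 * (n./2 - 1) + 3)%N by lia.
  exact: avoidable_odd.
have -> : n = (2 * (n./2 - 4).+1 + 6)%N by lia.
exact: avoidable_even.
Qed.

Lemma avoidable_left_of_center (R : realType) n (a b : R) : (3 <= n)%N ->
  b - a <= 2 / 15 -> a + b <= 1 -> avoidable n a b.
Proof.
move=> n3 hab hs.
have [h|h] := leP b (1 - 2 ^+ n.-1 / (2 ^+ n - 1)).
  by apply: avoidable_ones => //; lia.
have [en|n_neq3] := eqVneq n 3%N.
  rewrite en /= (_ : _ / _ = 4 / 7) in h; last by field.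
  by rewrite en; apply: (avoidable_sub _ _ _ _ _ _ _ _ (avoidable_3 R)); lra.
have [en|n_neq4] := eqVneq n 4%N.
  rewrite en /= (_ : _ / _ = 8 / 15) in h; last by field.
  (* The constant 2/15 is used exactly here: [b > 8 / 15] gives [a > 6 / 15]. *)
  rewrite en; have [hb|hb] := leP b (8 / 15).
    by apply: (avoidable_sub _ _ _ _ _ _ _ _ (avoidable_4_left R)); lra.
  by apply: (avoidable_sub _ _ _ _ _ _ _ _ (avoidable_4_center R)); lra.
have [en|n_neq6] := eqVneq n 6%N.
  rewrite en /= (_ : _ / _ = 32 / 63) in h; last by field.
  rewrite en; have [hb|hb] := leP b (34 / 63).
    by apply: (avoidable_sub _ _ _ _ _ _ _ _ (avoidable_6_left R)); lra.
  by apply: (avoidable_sub _ _ _ _ _ _ _ _ (avoidable_6_center R)); lra.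
have P : 16 <= 2 ^+ n :> R.
  have -> : 16 = 2 ^+ 4 :> R by rewrite -natrX.
  by rewrite ler_weXn2l ?ler1n //; lia.
have PE : 2 ^+ n = 2 * 2 ^+ n.-1 :> R by rewrite -exprS prednK //; lia.
(* This yields [b > 7 / 15], hence [a > 1 / 3], while [a + b <= 1] gives [b <= 17 / 30 < 4 / 7]. *)
have : 2 ^+ n.-1 / (2 ^+ n - 1) <= 8 / 15 :> R.
  by rewrite ler_pdivrMr; lra.
by move=> hP; apply: (avoidable_sub _ _ _ _ _ _ _ _ (avoidable_third R n n3 _ _)) => //; lra.
Qed.

Lemma avoidable_short (R : realType) n (a b : R) : (3 <= n)%N ->
  b - a <= 2 / 15 -> avoidable n a b.
Proof.
move=> n3 hab; have [hs|hs] := leP (a + b) 1.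
  exact: avoidable_left_of_center.
rewrite -[a](subKr 1) -[b](subKr 1); apply: avoidable_mirror; first by lia.
by apply: avoidable_left_of_center => //; lra.
Qed.

(** * Intervals longer than 3/7 *)

(** Each of the two 3-cycles cuts the unit interval into gaps of length at most 3/7. *)
Lemma bad3_long (R : realType) (a b : R) : 0 < a -> b < 1 ->
  3 / 7 < b - a -> bad a b 3.
Proof.
move=> ha hb hab; split=> // C [x [x01 [_ x3 xprime] ->]].
have x1 := xprime 1%N isT.
pose T := @doubling R.
suff : exists k, a < iter k T x < b.
  by case=> k hk; exists (iter k T x); split => //; exists k.
apply: contrapT => /forallNP hk.
have out z : ~ (a < z < b) -> z <= a \/ b <= z.
  move=> h; have [?|za] := leP z a; first by left.
  by right; rewrite leNgt; apply/negP => zb; apply: h; rewrite za.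
have Tcase z : (z <= 1 / 2 /\ T z = 2 * z) \/ (1 / 2 < z /\ T z = 2 * z - 1).
  rewrite /T; have [h|h] := lerP z (1 / 2).
    by left; rewrite doublingL.
  by right; rewrite doublingR.
move: x3 x1 (out _ (hk 0%N)) (out _ (hk 1%N)) (out _ (hk 2%N)) => /=.
rewrite -/T; move: (Tcase x) (Tcase (T x)) (Tcase (T (T x))).
move: (T (T (T x))) (T (T x)) (T x) => u z y.
(* The eight branches are the choices of three binary digits of [x]. Equal digits force [x = 0] or
   [x = 1], against [T x <> x]; the others give a multiple of 1/7. *)
move=> [[? ?]|[? ?]] [[? ?]|[? ?]] [[? ?]|[? ?]] ? xy h0 h1 h2;
  first [ by exfalso; apply: xy; lra
        | by case: h0 => ?; case: h1 => ?; case: h2 => ?; lra ].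
Qed.

Theorem corollary2p4 (R : realType) (a b : R) (ha : 0 < a) (hab : a < b) (hb : b < 1) :
  (b - a <= 2 / 15 -> (a, b) \in @D3 R) /\
  ((a, b) \in @D3 R -> b - a <= 3 / 7).
Proof.
split=> [h|].
  rewrite inE; split=> /=; [by lra | by lra | rewrite -subset0 => n hn].
  have [n3 _] := hn; apply: (avoidable_not_bad _ _ _ _ _ hn).
  exact: avoidable_short.
rewrite inE => -[_ _ /= B0]; rewrite leNgt; apply/negP => h.
by have : B a b 3%N; [exact: bad3_long | rewrite B0].
Qed.
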